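(* Let $\vec p$ be a list of propositional variables, $\pi(\vec p)$ any permutation of the list $\vec p$, and $k$ an integer. There are $\mathsf{posELNDT}$ proofs over the extension axioms $\mathcal T$ of both $t^{\vec p}_k\to t^{\pi(\vec p)}_k$ and $t^{\pi(\vec p)}_k\to t^{\vec p}_k$, of size polynomial in the size of these sequents.
   Context: eNDT formulas are built from propositional variables, constants $0,1$ and extension variables by $\vee$ and decisions $\mathrm{dec}(A,p,B)$ (''if $p$ then $B$ else $A$'', $p$ a propositional variable). $\mathrm{pd}(A,p,C):=\mathrm{dec}(A,p,A\vee C)$; positive formulas are those whose decisions are all of this form. Extension axioms $e\leftrightarrow A$ (standing for sequents $e\to A$, $A\to e$) must form a well-founded system (each defining formula only uses earlier extension variables). Threshold extension axioms $\mathcal T$: for every finite list $\vec p$ of propositional variables and every integer $k$ there is an extension variable $t^{\vec p}_k$, with axioms $t^{\epsilon}_0\leftrightarrow 1$, $t^{\epsilon}_k\leftrightarrow 0$ for $k\ne0$, and $t^{p\vec p}_k\leftrightarrow\mathrm{pd}(t^{\vec p}_k,p,t^{\vec p}_{k-1})$ ($\epsilon$ the empty list, $p\vec p$ the list with $p$ prepended). ($\mathcal T$ is infinite; any proof uses finitely many axioms.) $\mathsf{posELNDT}$: sequent calculus on multisets with initial sequents $0\to$, $\to1$, $p\to p$; cut; left/right weakening and contraction; $\vee$-left (from $\Gamma,A\to\Delta$ and $\Gamma,B\to\Delta$ infer $\Gamma,A\vee B\to\Delta$); $\vee$-right (from $\Gamma\to\Delta,A,B$ infer $\Gamma\to\Delta,A\vee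 B$); positive decision left (from $\Gamma,A\to\Delta$ and $\Gamma,p,B\to\Delta$ infer $\Gamma,\mathrm{pd}(A,p,B)\to\Delta$) and right (from $\Gamma\to\Delta,A,p$ and $\Gamma\to\Delta,A,B$ infer $\Gamma\to\Delta,\mathrm{pd}(A,p,B)$); all formulas positive. A proof over a set of extension axioms is a finite list of sequents each being an axiom sequent or derived from earlier ones by a rule (its conclusion may contain extension variables). Size = number of symbols. *)

(* Defs.v *)
From Stdlib Require Import List Permutation ZArith Lia.
Import ListNotations.

Set Implicit Arguments.
Unset Strict Implicit.
Unset Printing Implicit Defensive.

(** * eNDT formulas *)

Definition var : Type := nat.

(** [E] is the type of extension variables.  [Dec A p B] reads "if [p] then
    [B] else [A]": the 0-branch comes first. *)
Inductive form (E : Type) : Type :=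
| Var (p : var)
| Ext (e : E)
| Zero
| One
| Or (A B : form E)
| Dec (A : form E) (p : var) (B : form E).

Arguments Var {E} p.
Arguments Ext {E} e.
Arguments Zero {E}.
Arguments One {E}.

Definition pd (E : Type) (A : form E) (p : var) (C : form E) : form E :=
  Dec A p (Or A C).

Inductive positive (E : Type) : form E -> Prop :=
| pos_Var p : positive (Var p)
| pos_Ext e : positive (Ext e)
| pos_Zero : positive Zero
| pos_One : positive One
| pos_Or A B : positive A -> positive B -> positive (Or A B)
| pos_pd A p C : positive A -> positive C -> positive (pd A p C).

(** * Sequents *)

(** Both cedents are multisets: they are represented by lists, and sequents
    are only ever compared up to [seq_equiv]. *)
Record sequent (E : Type) : Type :=
  Sequent { antecedent : list (form E); succedent : list (form E) }.

Notation "G ⊢ D" := (Sequent G D) (at level 70, no associativity).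

Definition seq_equiv (E : Type) (S S' : sequent E) : Prop :=
  Permutation (antecedent S) (antecedent S') /\
  Permutation (succedent S) (succedent S').

Definition positive_seq (E : Type) (S : sequent E) : Prop :=
  Forall (@positive E) (antecedent S) /\ Forall (@positive E) (succedent S).

(** * Extension axioms *)

(** [T e A] means that [e <-> A] belongs to the set [T]. *)
Definition ext_axioms (E : Type) : Type := E -> form E -> Prop.

Fixpoint occurs (E : Type) (e : E) (A : form E) : Prop :=
  match A with
  | Ext e' => e = e'
  | Or A B => occurs e A \/ occurs e B
  | Dec A _ B => occurs e A \/ occurs e B
  | _ => False
  end.

Definition wf_ext_axioms (E : Type) (T : ext_axioms E) : Prop :=
  (forall e A B, T e A -> T e B -> A = B) /\
  well_founded (fun e' e => exists A, T e A /\ occurs e' A).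

(** * The system posELNDT over a set of extension axioms *)

(** [rule T Ps C]: [C] follows from the premises [Ps]; initial sequents and
    extension axioms are the rules without premises. *)
Inductive rule (E : Type) (T : ext_axioms E) :
  list (sequent E) -> sequent E -> Prop :=
| r_zero : rule T [] ([Zero] ⊢ [])
| r_one : rule T [] ([] ⊢ [One])
| r_id p : rule T [] ([Var p] ⊢ [Var p])
| r_ext_l e A : T e A -> rule T [] ([Ext e] ⊢ [A])
| r_ext_r e A : T e A -> rule T [] ([A] ⊢ [Ext e])
| r_cut G D A : rule T [G ⊢ A :: D; A :: G ⊢ D] (G ⊢ D)
| r_weak_l G D A : rule T [G ⊢ D] (A :: G ⊢ D)
| r_weak_r G D A : rule T [G ⊢ D] (G ⊢ A :: D)
| r_contr_l G D A : rule T [A :: A :: G ⊢ D] (A :: G ⊢ D)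
| r_contr_r G D A : rule T [G ⊢ A :: A :: D] (G ⊢ A :: D)
| r_or_l G D A B :
    rule T [A :: G ⊢ D; B :: G ⊢ D] (Or A B :: G ⊢ D)
| r_or_r G D A B :
    rule T [G ⊢ A :: B :: D] (G ⊢ Or A B :: D)
| r_pd_l G D A p B :
    rule T [A :: G ⊢ D; Var p :: B :: G ⊢ D] (pd A p B :: G ⊢ D)
| r_pd_r G D A p B :
    rule T [G ⊢ A :: Var p :: D; G ⊢ A :: B :: D] (G ⊢ pd A p B :: D).

Definition inferred (E : Type) (T : ext_axioms E)
    (earlier : list (sequent E)) (S : sequent E) : Prop :=
  exists Ps C, rule T Ps C /\ seq_equiv C S /\
    forall P, In P Ps -> exists P', In P' earlier /\ seq_equiv P P'.

Inductive derivation (E : Type) (T : ext_axioms E) :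
  list (sequent E) -> Prop :=
| d_nil : derivation T []
| d_snoc pf S :
    derivation T pf -> positive_seq S -> inferred T pf S ->
    derivation T (pf ++ [S]).

Definition proof_of (E : Type) (T : ext_axioms E)
    (pf : list (sequent E)) (S : sequent E) : Prop :=
  derivation T pf /\ exists pf', pf = pf' ++ [S].

(** * Size: number of symbols *)

(** [esz e] is the number of symbols needed to write the extension
    variable [e]. *)
Fixpoint form_size (E : Type) (esz : E -> nat) (A : form E) : nat :=
  match A with
  | Var _ | Zero | One => 1
  | Ext e => esz e
  | Or A B => 1 + form_size esz A + form_size esz B
  | Dec A _ B => 2 + form_size esz A + form_size esz B
  end.

Definition seq_size (E : Type) (esz : E -> nat) (S : sequent E) : nat :=
  1 + list_sum (map (form_size esz) (antecedent S))
    + list_sum (map (form_size esz) (succedent S)).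

Definition proof_size (E : Type) (esz : E -> nat) (pf : list (sequent E))
    : nat :=
  list_sum (map (seq_size esz) pf).

(** * Threshold extension variables and axioms *)

(** [Thr ps k] is the extension variable t with superscript [ps] and
    subscript [k]. *)
Inductive thr : Type := Thr (ps : list var) (k : Z).

Inductive thr_axioms : ext_axioms thr :=
| thr_nil_0 : thr_axioms (Thr [] 0) One
| thr_nil k : k <> 0%Z -> thr_axioms (Thr [] k) Zero
| thr_cons p ps k :
    thr_axioms (Thr (p :: ps) k)
      (pd (Ext (Thr ps k)) p (Ext (Thr ps (k - 1)))).

(** A threshold variable is charged for its indices (counting it as a single
    symbol would make the size of a sequent blind to them): one symbol per entry
    of the list, and the signed binary numeral for the subscript. *)
Definition numeral_size (k : Z) : nat :=
  match k with
  | Z0 => 1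
  | Zpos n => Pos.size_nat n
  | Zneg n => 1 + Pos.size_nat n
  end.

Definition thr_size (t : thr) : nat :=
  let (ps, k) := t in 1 + length ps + numeral_size k.

Lemma thr_axioms_wf : wf_ext_axioms thr_axioms.
Proof.
split.
- intros e A B HA HB.
  destruct HA; inversion HB; subst; congruence.
- assert (H : forall ps k,
    Acc (fun e' e => exists A, thr_axioms e A /\ occurs e' A) (Thr ps k)).
  { induction ps as [|p ps IH]; intros k; constructor; intros e' [A [HA Ho]];
      inversion HA; subst; simpl in Ho.
    - contradiction.
    - contradiction.
    - destruct Ho as [->|[->| ->]]; apply IH. }
  intros [ps k]. apply H.
Qed.

Lemma thr_axioms_positive e A : thr_axioms e A -> positive A.
Proof. intros []; repeat constructor. Qed.

(* Main.v *)
Require Import Defs.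
From Stdlib Require Import List Permutation ZArith.
From Stdlib Require Import Lia ArithRing.
Import ListNotations.

(** Induction on [ps].  Unfolding one threshold axiom on each side, the
    implications between [p :: ps] and [p :: qs] follow from those between [ps]
    and [qs] at the subscripts [j] and [j - 1]; so [p :: ps] may be replaced by
    [p :: q1 ++ q2], and it remains to move [p] past the entries of [q1] one by
    one.  A transposition [p :: q :: ps] to [q :: p :: ps] has a proof with
    boundedly many lines, both sides having the same disjunctive form over [ps].
    To stay polynomial, each list is treated at all relevant subscripts
    [k, k - 1, ..., k - n] together, so that every implication is proved once and
    shared: [O(n)] lines per step, [O(n^2)] steps, lines of linear size. *)

Set Implicit Arguments.
Unset Strict Implicit.
Unset Printing Implicit Defensive.

(** * Sequents up to multiset equality, and prefixes of derivations *)

Lemma seq_equiv_refl (E : Type) (S : sequent E) : seq_equiv S S.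
Proof. split; reflexivity. Qed.

Lemma seq_equiv_sym (E : Type) (S S' : sequent E) :
  seq_equiv S S' -> seq_equiv S' S.
Proof. intros [H1 H2]; split; symmetry; assumption. Qed.

Lemma seq_equiv_trans (E : Type) (S1 S2 S3 : sequent E) :
  seq_equiv S1 S2 -> seq_equiv S2 S3 -> seq_equiv S1 S3.
Proof. intros [H1 H2] [H3 H4]; split; etransitivity; eassumption. Qed.

(** This is how [inferred] looks up a premise: among earlier lines, up to multiset equality. *)
Definition lists (E : Type) (pf : list (sequent E)) (S : sequent E) : Prop :=
  exists S', In S' pf /\ seq_equiv S S'.

Lemma lists_app_l (E : Type) (pf b : list (sequent E)) S :
  lists pf S -> lists (pf ++ b) S.
Proof.
intros (S' & HS' & He). exists S'; split; [apply in_or_app; auto | exact He].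
Qed.

Lemma lists_last (E : Type) (pf : list (sequent E)) S : lists (pf ++ [S]) S.
Proof.
exists S; split; [apply in_or_app; right; left; reflexivity
                 | apply seq_equiv_refl].
Qed.

(** Each line refers only to earlier ones. This allows a shared proof to be cut right after the
    wanted sequent, which [proof_of] requires to be the last line. *)
Lemma derivation_prefix (E : Type) (T : ext_axioms E) pf1 pf2 :
  derivation T (pf1 ++ pf2) -> derivation T pf1.
Proof.
induction pf2 as [|S pf2 IH] using rev_ind; intros H.
- rewrite app_nil_r in H; exact H.
- apply IH. rewrite app_assoc in H. inversion H as [Hn | pf S' H1 _ _ Hn].
  + destruct (pf1 ++ pf2); discriminate.
  + apply app_inj_tail in Hn. destruct Hn as [<- _]; exact H1.
Qed.

(** Large enough for every sequent in the proof of a transposition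
    ([der_pd_swap]). *)
Definition width : nat := 12.

(** * Good sequents, and extending a proof by a counted block of lines *)

Section Derivability.

Variables (E : Type) (T : ext_axioms E) (F : form E -> Prop).
Hypothesis F_positive : forall A, F A -> Defs.positive A.

(** [F] is a class of positive formulas, later those of linear size. With the number of formulas
    bounded as well, counting lines is enough to bound symbols. *)
Definition good (S : sequent E) : Prop :=
  Forall F (antecedent S) /\ Forall F (succedent S) /\
  length (antecedent S) + length (succedent S) <= width.

Lemma good_equiv S S' : seq_equiv S S' -> good S -> good S'.
Proof.
intros [HG HD] (H1 & H2 & H3). repeat split.
- eapply Permutation_Forall; eassumption.
- eapply Permutation_Forall; eassumption.
- rewrite <- (Permutation_length HG), <- (Permutation_length HD); exact H3.
Qed.

(** Tree-like derivations from hypotheses [H]; the index bounds the number of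
    lines needed to extend a proof containing [H], so hypotheses are free. *)
Inductive der (H : sequent E -> Prop) : nat -> sequent E -> Prop :=
| der_hyp n S : H S -> good S -> der H n S
| der_equiv n S S' : seq_equiv S S' -> der H n S -> der H n S'
| der_0 m S : rule T [] S -> good S -> 0 < m -> der H m S
| der_1 n m P S :
    rule T [P] S -> good S -> der H n P -> n < m -> der H m S
| der_2 n1 n2 m P1 P2 S :
    rule T [P1; P2] S -> good S -> der H n1 P1 -> der H n2 P2 ->
    n1 + n2 < m -> der H m S.

Lemma der_good H n S : der H n S -> good S.
Proof.
intros D; induction D; auto. eapply good_equiv; eassumption.
Qed.

Lemma der_mono H n m S : der H n S -> n <= m -> der H m S.
Proof.
intros D; revert m; induction D; intros m' Hm.
- apply der_hyp; assumption.
- eapply der_equiv; eauto.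
- apply der_0; auto; lia.
- eapply der_1; eauto; lia.
- eapply der_2; eauto; lia.
Qed.

Lemma derivation_snoc_rule pf Ps S :
  derivation T pf -> rule T Ps S -> good S ->
  (forall P, In P Ps -> lists pf P) -> derivation T (pf ++ [S]).
Proof.
intros Hpf HR (HG & HD & _) HPs. constructor; auto.
- split; eapply Forall_impl; eauto.
- exists Ps, S. split; [exact HR | split; [apply seq_equiv_refl|]].
  intros P HP; apply HPs; exact HP.
Qed.

(** Quantifying over every proof [pf] lets blocks be appended to one another, which gives the
    sharing that trees lack. Only the new lines have to be good. *)
Definition extends_by (n : nat) (H G : sequent E -> Prop) : Prop :=
  forall pf, derivation T pf -> (forall S, H S -> lists pf S) ->
  exists b, length b <= n /\ Forall good b /\ derivation T (pf ++ b) /\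
    forall S, G S -> lists (pf ++ b) S.

Lemma extends_by_mono n n' (H G G' : sequent E -> Prop) :
  extends_by n H G -> n <= n' -> (forall S, G' S -> G S) ->
  extends_by n' H G'.
Proof.
intros HE Hn HG pf Hpf HH. destruct (HE pf Hpf HH) as (b & H1 & H2 & H3 & H4).
exists b. repeat split; auto; lia.
Qed.

(** Line counts add, however often the second block uses a sequent of [G]: it is listed once and
    then free. *)
Lemma extends_by_trans n n' (H G K : sequent E -> Prop) :
  extends_by n H G -> extends_by n' G K -> extends_by (n + n') H K.
Proof.
intros H1 H2 pf Hpf HH.
destruct (H1 pf Hpf HH) as (b & L1 & F1 & D1 & I1).
destruct (H2 _ D1 I1) as (b' & L2 & F2 & D2 & I2).
exists (b ++ b'). rewrite length_app, app_assoc.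
split; [lia|]. split; [apply Forall_app; auto|]. auto.
Qed.

Lemma extends_by_union n n' (H G G' : sequent E -> Prop) :
  extends_by n H G -> extends_by n' H G' ->
  extends_by (n + n') H (fun S => G S \/ G' S).
Proof.
intros H1 H2 pf Hpf HH.
destruct (H1 pf Hpf HH) as (b & L1 & F1 & D1 & I1).
destruct (H2 _ D1 (fun S HS => lists_app_l b (HH S HS)))
  as (b' & L2 & F2 & D2 & I2).
exists (b ++ b'). rewrite length_app, app_assoc.
split; [lia|]. split; [apply Forall_app; auto|]. split; [exact D2|].
intros S [HS|HS]; auto using lists_app_l.
Qed.

(** The tree is written out premises first; a hypothesis is already listed up to equivalence and
    adds no line. *)
Lemma der_extends_by H n S : der H n S -> extends_by n H (eq S).
Proof.
intros D; induction D as
  [n S HS HgS | n S S' He D IH | m S HR HgS Hm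
  | n m P S HR HgS D IH Hm | n1 n2 m P1 P2 S HR HgS D1 IH1 D2 IH2 Hm];
  intros pf Hpf HH.
- exists []. rewrite app_nil_r. simpl. repeat split; auto; [lia|].
  intros ? <-; auto.
- destruct (IH pf Hpf HH) as (b & L1 & F1 & Db & I1).
  exists b. repeat split; auto. intros ? <-.
  destruct (I1 S eq_refl) as (S1 & HS1 & He1).
  exists S1; split; [exact HS1|].
  eapply seq_equiv_trans; [apply seq_equiv_sym; exact He | exact He1].
- exists [S]. simpl. repeat split; auto.
  + eapply derivation_snoc_rule; eauto. intros P [].
  + intros ? <-; apply lists_last.
- destruct (IH pf Hpf HH) as (b & L1 & F1 & Db & I1).
  exists (b ++ [S]). rewrite length_app, app_assoc. simpl.
  split; [lia|]. split; [apply Forall_app; auto|]. split.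
  + eapply derivation_snoc_rule; eauto. intros P' [<-|[]]; auto.
  + intros ? <-; apply lists_last.
- destruct (extends_by_union IH1 IH2 Hpf HH) as (b & L1 & F1 & Db & I1).
  exists (b ++ [S]). rewrite length_app, app_assoc. simpl.
  split; [lia|]. split; [apply Forall_app; auto|]. split.
  + eapply derivation_snoc_rule; eauto. intros P' [<-|[<-|[]]]; auto.
  + intros ? <-; apply lists_last.
Qed.

Lemma der_family_extends_by H c n (f : nat -> sequent E) :
  (forall i, i < n -> der H c (f i)) ->
  extends_by (c * n) H (fun S => exists i, i < n /\ f i = S).
Proof.
induction n as [|n IH]; intros Hf.
- intros pf Hpf HH. exists []. rewrite app_nil_r.
  repeat split; simpl; auto; [lia|]. intros S (i & Hi & _); lia.
- assert (Hn : n < Datatypes.S n) by lia.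
  pose proof (extends_by_union
    (IH (fun i Hi => Hf i (Nat.lt_lt_succ_r _ _ Hi)))
    (der_extends_by (Hf n Hn))) as HU.
  eapply extends_by_mono; [exact HU | lia |].
  intros S (i & Hi & <-).
  destruct (Nat.eq_dec i n) as [->|Hne]; [auto|].
  left; exists i; split; [lia | reflexivity].
Qed.

(** * Derived rules with their line counts *)

Lemma der_weaken H n G D G' D' :
  der H n (G ⊢ D) -> good (G' ++ G ⊢ D' ++ D) ->
  der H (n + length G' + length D') (G' ++ G ⊢ D' ++ D).
Proof.
intros HD; revert D'. induction G' as [|A G' IH]; intros D' Hg.
- induction D' as [|B D' IH']; simpl.
  + eapply der_mono; [exact HD | lia].
  + simpl in Hg. eapply der_1; [apply r_weak_r | exact Hg | apply IH' | simpl; lia].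
    destruct Hg as (H1 & H2 & H3); simpl in *; inversion H2; subst.
    repeat split; simpl; auto; lia.
- simpl. eapply der_1; [apply r_weak_l | exact Hg | apply IH | lia].
  destruct Hg as (H1 & H2 & H3); simpl in *; inversion H1; subst.
  repeat split; simpl; auto; lia.
Qed.

(** All formulas other than the two copies of [A] are added by weakening, and a good sequent has
    fewer than [width] of them. *)
Lemma der_initial H n A G D :
  der H n ([A] ⊢ [A]) -> In A G -> In A D -> good (G ⊢ D) ->
  der H (n + width) (G ⊢ D).
Proof.
intros HA HG HD Hg.
destruct (in_split _ _ HG) as (G1 & G2 & ->).
destruct (in_split _ _ HD) as (D1 & D2 & ->).
assert (He : seq_equiv ((G1 ++ G2) ++ [A] ⊢ (D1 ++ D2) ++ [A])
                       (G1 ++ A :: G2 ⊢ D1 ++ A :: D2)).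
{ split; simpl; rewrite <- app_assoc; apply Permutation_app_head;
    symmetry; apply Permutation_cons_append. }
pose proof Hg as (_ & _ & Hw). simpl in Hw.
rewrite !length_app in Hw; simpl in Hw.
eapply der_equiv; [exact He|].
eapply der_mono; [apply der_weaken; [exact HA|] |].
- eapply good_equiv; [apply seq_equiv_sym; exact He | exact Hg].
- rewrite !length_app. lia.
Qed.

Lemma der_cut H n1 n2 m G D A :
  der H n1 (G ⊢ A :: D) -> der H n2 (A :: G ⊢ D) -> n1 + n2 < m ->
  der H m (G ⊢ D).
Proof.
intros H1 H2 Hm. eapply der_2; [apply r_cut | | exact H1 | exact H2 | exact Hm].
apply der_good in H1; apply der_good in H2.
destruct H1 as (? & _ & Hw), H2 as (_ & ? & _). simpl in *.
repeat split; simpl; auto; lia.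
Qed.

(** The cut rule shares its contexts, so each premise is first weakened; with the cut itself this
    makes 3 extra lines. *)
Lemma der_cut_single H n1 n2 A B C :
  der H n1 ([A] ⊢ [B]) -> der H n2 ([B] ⊢ [C]) ->
  der H (n1 + n2 + 3) ([A] ⊢ [C]).
Proof.
intros H1 H2.
pose proof (der_good H1) as (FA & FB & _).
pose proof (der_good H2) as (_ & FC & _). simpl in *.
inversion FA; inversion FB; inversion FC; subst.
eapply der_cut with (A := B).
- eapply der_equiv with (S := [A] ⊢ [C; B]).
  + split; simpl; [reflexivity | apply perm_swap].
  + eapply der_1; [apply r_weak_r | | exact H1 | apply Nat.lt_succ_diag_r].
    repeat split; simpl; auto; unfold width; lia.
- eapply der_equiv with (S := [A; B] ⊢ [C]).
  + split; simpl; [apply perm_swap | reflexivity].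
  + eapply der_1; [apply r_weak_l | | exact H2 | apply Nat.lt_succ_diag_r].
    repeat split; simpl; auto; unfold width; lia.
- lia.
Qed.

Lemma der_var H p : F (Var p) -> der H 1 ([Var p] ⊢ [Var p]).
Proof.
intros Hp. apply der_0; [constructor | | lia].
repeat split; simpl; auto; unfold width; lia.
Qed.

(** Among variables, identity is initial only for propositional ones. For [e] it is a cut of its two
    axioms on the defining formula: 1 + 1 + 3 lines. *)
Lemma der_ext H e A :
  T e A -> F (Ext e) -> F A -> der H 5 ([Ext e] ⊢ [Ext e]).
Proof.
intros HT He HA. apply (@der_cut_single H 1 1 _ A).
- apply der_0; [constructor; exact HT | | lia].
  repeat split; simpl; auto; unfold width; lia.
- apply der_0; [constructor; exact HT | | lia].
  repeat split; simpl; auto; unfold width; lia.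
Qed.

(** A cut on the defining formula [A]. The side condition leaves room for both [Ext e] and [A] in
    the premises of the cut. *)
Lemma der_ext_l H n e A G D :
  T e A -> F (Ext e) -> der H n (A :: G ⊢ D) ->
  length G + length D + 2 <= width ->
  der H (n + width + 2) (Ext e :: G ⊢ D).
Proof.
intros HT He HD Hw.
pose proof (der_good HD) as (FG & FD & _). simpl in *.
inversion FG as [|A' G' HA HG]; subst.
apply der_cut with (A := A) (n1 := width) (n2 := n + 1); [| |lia].
- eapply der_equiv with (S := G ++ [Ext e] ⊢ D ++ [A]).
  + split; simpl; symmetry; apply Permutation_cons_append.
  + eapply der_mono; [apply der_weaken with (n := 1) |].
    * apply der_0; [constructor; exact HT | | lia].
      repeat split; simpl; auto; unfold width; lia.
    * repeat split; simpl; try (apply Forall_app; auto).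
      rewrite !length_app; simpl; lia.
    * lia.
- eapply der_equiv with (S := Ext e :: A :: G ⊢ D).
  + split; simpl; [apply perm_swap | reflexivity].
  + eapply der_1; [apply r_weak_l | | exact HD | lia].
    repeat split; simpl; auto; lia.
Qed.

Lemma der_ext_r H n e A G D :
  T e A -> F (Ext e) -> der H n (G ⊢ A :: D) ->
  length G + length D + 2 <= width ->
  der H (n + width + 2) (G ⊢ Ext e :: D).
Proof.
intros HT He HD Hw.
pose proof (der_good HD) as (FG & FD & _). simpl in *.
inversion FD as [|A' D' HA HD']; subst.
apply der_cut with (A := A) (n1 := n + 1) (n2 := width); [| |lia].
- eapply der_equiv with (S := G ⊢ Ext e :: A :: D).
  + split; simpl; [reflexivity | apply perm_swap].
  + eapply der_1; [apply r_weak_r | | exact HD | lia].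
    repeat split; simpl; auto; lia.
- eapply der_equiv with (S := G ++ [A] ⊢ D ++ [Ext e]).
  + split; simpl; symmetry; apply Permutation_cons_append.
  + eapply der_mono; [apply der_weaken with (n := 1) |].
    * apply der_0; [constructor; exact HT | | lia].
      repeat split; simpl; auto; unfold width; lia.
    * repeat split; simpl; try (apply Forall_app; auto).
      rewrite !length_app; simpl; lia.
    * lia.
Qed.

Lemma der_pd_ext_l H n1 n2 e A p B G D :
  T e (pd A p B) -> F (Ext e) -> F (pd A p B) ->
  length G + length D + 2 <= width ->
  der H n1 (A :: G ⊢ D) -> der H n2 (Var p :: B :: G ⊢ D) ->
  der H (n1 + n2 + 15) (Ext e :: G ⊢ D).
Proof.
intros HT He Hpd Hw H1 H2.
(* The 15 is one line for the decision rule and [width + 2] for unfolding [e]. *)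
eapply der_mono with (n := (n1 + n2 + 1) + width + 2); [| unfold width; lia].
eapply der_ext_l; eauto.
pose proof (der_good H1) as (FG & FD & _). simpl in *.
inversion FG; subst.
eapply der_2; [apply r_pd_l | | exact H1 | exact H2 | lia].
repeat split; simpl; auto; lia.
Qed.

Lemma der_pd_ext_r H n1 n2 e A p B G D :
  T e (pd A p B) -> F (Ext e) -> F (pd A p B) ->
  length G + length D + 2 <= width ->
  der H n1 (G ⊢ A :: Var p :: D) -> der H n2 (G ⊢ A :: B :: D) ->
  der H (n1 + n2 + 15) (G ⊢ Ext e :: D).
Proof.
intros HT He Hpd Hw H1 H2.
eapply der_mono with (n := (n1 + n2 + 1) + width + 2); [| unfold width; lia].
eapply der_ext_r; eauto.
pose proof (der_good H1) as (FG & FD & _). simpl in *.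
inversion FD as [|? ? ? FD']; inversion FD'; subst.
eapply der_2; [apply r_pd_r | | exact H1 | exact H2 | lia].
repeat split; simpl; auto; lia.
Qed.

(** In the branch with [A], both premises of the right decision weaken the first hypothesis, hence
    the factor 2. In the branch with [p] and [B], one premise is an identity on [p] and the other
    weakens the second hypothesis. *)
Lemma der_pd_congr H n1 n2 e e' A A' p B B' :
  T e (pd A p B) -> F (Ext e) -> F (pd A p B) ->
  T e' (pd A' p B') -> F (Ext e') -> F (pd A' p B') -> F (Var p) ->
  der H n1 ([A] ⊢ [A']) -> der H n2 ([B] ⊢ [B']) ->
  der H (2 * n1 + n2 + 100) ([Ext e] ⊢ [Ext e']).
Proof.
intros HT He Hpd HT' He' Hpd' Hp H1 H2.
pose proof (der_good H1) as (FA & FA' & _).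
pose proof (der_good H2) as (FB & FB' & _). simpl in *.
inversion FA; inversion FA'; inversion FB; inversion FB'; subst.
eapply der_mono with (n := ((n1 + 1) + (n1 + 1) + 15)
  + ((1 + width) + (n2 + 3) + 15) + 15); [| unfold width; lia].
eapply der_pd_ext_l; eauto; try (simpl; unfold width; lia).
- eapply der_pd_ext_r; eauto; try (simpl; unfold width; lia).
  + eapply der_equiv with (S := [A] ⊢ [Var p; A']);
      [split; simpl; [reflexivity | apply perm_swap]|].
    eapply der_1; [apply r_weak_r | | exact H1 | lia].
    repeat split; simpl; auto; unfold width; lia.
  + eapply der_equiv with (S := [A] ⊢ [B'; A']);
      [split; simpl; [reflexivity | apply perm_swap]|].
    eapply der_1; [apply r_weak_r | | exact H1 | lia].
    repeat split; simpl; auto; unfold width; lia.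
- eapply der_pd_ext_r; eauto; try (simpl; unfold width; lia).
  + eapply der_initial; [apply der_var; exact Hp | simpl; auto | simpl; auto |].
    repeat split; simpl; auto; unfold width; lia.
  + eapply der_mono with (n := n2 + length [Var (E := E) p] + length [A']);
      [|simpl; lia].
    apply (@der_weaken H n2 [B] [B'] [Var p] [A']); auto.
    repeat split; simpl; auto; unfold width; lia.
Qed.

(** Both sides unfold to [a0 \/ (q /\ a1) \/ (p /\ a1) \/ (p /\ q /\ a2)]. *)
Lemma der_pd_swap H p q e u v e' u' v' a0 a1 a2 :
  T e (pd (Ext u) p (Ext v)) -> T u (pd a0 q a1) -> T v (pd a1 q a2) ->
  T e' (pd (Ext u') q (Ext v')) -> T u' (pd a0 p a1) -> T v' (pd a1 p a2) ->
  (forall x, In x [Ext e; Ext u; Ext v; Ext e'; Ext u'; Ext v'; a0; a1; a2;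
     Var p; Var q; pd (Ext u) p (Ext v); pd a0 q a1; pd a1 q a2;
     pd (Ext u') q (Ext v'); pd a0 p a1; pd a1 p a2] -> F x) ->
  (forall x, In x [a0; a1; a2] -> der H 5 ([x] ⊢ [x])) ->
  der H 1000 ([Ext e] ⊢ [Ext e']).
Proof.
intros Te Tu Tv Te' Tu' Tv' HF Hid.
assert (Hid' : forall x, In x [a0; a1; a2; Var p; Var q] ->
  der H 5 ([x] ⊢ [x])).
{ intros x [<-|[<-|[<-|[<-|[<-|[]]]]]];
    try (apply Hid; simpl; auto; fail);
    (eapply der_mono; [apply der_var, HF; simpl; tauto | lia]). }
assert (HFl : forall L, incl L [Ext e; Ext u; Ext v; Ext e'; Ext u'; Ext v';
  a0; a1; a2; Var p; Var q] -> Forall F L).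
{ intros L HL. apply Forall_forall. intros x Hx. apply HF.
  apply HL in Hx. simpl in *; tauto. }
(* 17 is 5 lines for the identity plus at most [width] weakenings. *)
assert (leaf : forall x G D, In x [a0; a1; a2; Var p; Var q] ->
  In x G -> In x D -> incl G [a0; a1; a2; Var p; Var q] ->
  incl D [a0; a1; a2; Var p; Var q] -> length G + length D <= width ->
  der H 17 (G ⊢ D)).
{ intros x G D Hx HG HD IG ID Hw.
  apply (@der_initial H 5 x); auto. repeat split; auto;
  apply HFl; intros y Hy; [apply IG in Hy | apply ID in Hy];
    simpl in *; tauto. }
(* The condition on [G] lists the four disjuncts of the common form; these are the antecedents left
   after decomposing [e]. *)
assert (right : forall G, length G <= 3 ->
  incl G [a0; a1; a2; Var p; Var q] ->
  In a0 G \/ (In a1 G /\ In (Var q) G) \/ (In a1 G /\ In (Var p) G) \/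
    (In a2 G /\ In (Var p) G /\ In (Var q) G) ->
  der H 200 (G ⊢ [Ext e'])).
{ intros G LG IG HG.
  (* Dually, decomposing [e'] leaves succedents that act as clauses of a conjunctive form. Each
     disjunct shares a formula with each clause, so every leaf is a weakened identity. *)
  assert (leaf' : forall D, length D <= 4 ->
    incl D [a0; a1; a2; Var p; Var q] ->
    (In a0 D /\ (In a1 D \/ (In (Var p) D /\ In (Var q) D)) /\
      (In a2 D \/ In (Var p) D \/ In (Var q) D)) ->
    der H 17 (G ⊢ D)).
  { intros D LD ID HD.
    assert (Hx : exists x, In x G /\ In x D).
    { destruct HG as [HG|[[HG HG']|[[HG HG']|[HG [HG' HG'']]]]].
      - exists a0; tauto.
      - destruct HD as (_ & [HD|[HD HD']] & _);
          [exists a1 | exists (Var q)]; auto.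
      - destruct HD as (_ & [HD|[HD HD']] & _);
          [exists a1 | exists (Var p)]; auto.
      - destruct HD as (_ & _ & [HD|[HD|HD]]);
          [exists a2 | exists (Var p) | exists (Var q)]; auto. }
    destruct Hx as (x & HxG & HxD).
    apply leaf with (x := x); auto; unfold width; lia. }
  eapply der_mono with (n := (17 + 17 + 15)
     + ((17 + 17 + 15) + (17 + 17 + 15) + 15) + 15); [|lia].
  eapply der_pd_ext_r; [exact Te' | | | | |];
    try (apply HF; simpl; tauto); try (simpl; unfold width; lia).
  - eapply der_pd_ext_r; [exact Tu' | | | | |];
      try (apply HF; simpl; tauto); try (simpl; unfold width; lia).
    + apply leaf'; [simpl; lia | intros y; simpl; tauto | simpl; tauto].
    + apply leaf'; [simpl; lia | intros y; simpl; tauto | simpl; tauto].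
  - assert (rot : forall n x y, der H n (G ⊢ [Ext v'; x; y]) ->
      der H n (G ⊢ [x; y; Ext v'])).
    { intros n x y. apply der_equiv. split; simpl; [reflexivity|].
      apply (Permutation_cons_append [x; y]). }
    eapply der_pd_ext_r; [exact Tu' | | | | |];
      try (apply HF; simpl; tauto); try (simpl; unfold width; lia).
    + apply rot. eapply der_pd_ext_r; [exact Tv' | | | | |];
        try (apply HF; simpl; tauto); try (simpl; unfold width; lia).
      * apply leaf'; [simpl; lia | intros y; simpl; tauto | simpl; tauto].
      * apply leaf'; [simpl; lia | intros y; simpl; tauto | simpl; tauto].
    + apply rot. eapply der_pd_ext_r; [exact Tv' | | | | |];
        try (apply HF; simpl; tauto); try (simpl; unfold width; lia).
      * apply leaf'; [simpl; lia | intros y; simpl; tauto | simpl; tauto].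
      * apply leaf'; [simpl; lia | intros y; simpl; tauto | simpl; tauto]. }
eapply der_mono with (n := (200 + 200 + 15) + (200 + 200 + 15) + 15); [|lia].
eapply der_pd_ext_l; [exact Te | | | | |];
  try (apply HF; simpl; tauto); try (simpl; unfold width; lia).
- eapply der_pd_ext_l; [exact Tu | | | | |];
    try (apply HF; simpl; tauto); try (simpl; unfold width; lia).
  + apply right; [simpl; lia | intros y; simpl; tauto | simpl; tauto].
  + apply right; [simpl; lia | intros y; simpl; tauto | simpl; tauto].
- eapply der_equiv with (S := [Ext v; Var p] ⊢ [Ext e']);
    [split; simpl; [apply perm_swap | reflexivity]|].
  eapply der_pd_ext_l; [exact Tv | | | | |];
    try (apply HF; simpl; tauto); try (simpl; unfold width; lia).
  + apply right; [simpl; lia | intros y; simpl; tauto | simpl; tauto].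
  + apply right; [simpl; lia | intros y; simpl; tauto | simpl; tauto].
Qed.

End Derivability.

(** * Growth of subscript numerals *)

Lemma size_nat_succ n : Pos.size_nat (Pos.succ n) <= S (Pos.size_nat n).
Proof. induction n; simpl; lia. Qed.

Lemma size_nat_pred_double n : Pos.size_nat (Pos.pred_double n) <= S (Pos.size_nat n).
Proof. induction n; simpl in *; lia. Qed.

Lemma numeral_size_pred k : numeral_size (k - 1) <= S (numeral_size k).
Proof.
destruct k as [|[n|n|]|n]; simpl; try lia.
- apply le_S, size_nat_pred_double.
- rewrite Pos.add_1_r. pose proof (size_nat_succ n). lia.
Qed.

(** A crude linear bound suffices: [i] stays below the length of the list, which is already charged
    for in the size. *)
Lemma numeral_size_sub k i : numeral_size (k - Z.of_nat i) <= numeral_size k + i.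
Proof.
induction i as [|i IH].
- replace (k - Z.of_nat 0)%Z with k by lia. lia.
- replace (k - Z.of_nat (S i))%Z with (k - Z.of_nat i - 1)%Z by lia.
  pose proof (numeral_size_pred (k - Z.of_nat i)). lia.
Qed.

(** * Permuting the list of a threshold variable *)

Section Threshold.

Variables (K : Z) (N : nat).

(** Only subscripts [K - i] with [i + length ps <= N] are used: this region is
    closed under unfolding the threshold axioms. *)
Definition thr_at (ps : list var) (i : nat) : thr := Thr ps (K - Z.of_nat i).

(** The factor 6 covers the largest formulas used: [pd] of two threshold variables has 3 symbols
    besides three occurrences of threshold variables. *)
Definition bounded (A : form thr) : Prop :=
  Defs.positive A /\
  form_size thr_size A <= 6 * (1 + N + numeral_size K).

Let bounded_positive A : bounded A -> Defs.positive A.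
Proof. intros [H _]; exact H. Qed.

Lemma thr_at_size ps i :
  i + length ps <= N -> thr_size (thr_at ps i) <= 1 + N + numeral_size K.
Proof.
intros H. unfold thr_at, thr_size. pose proof (numeral_size_sub K i). lia.
Qed.

Lemma bounded_var p : bounded (Var p).
Proof. split; [constructor | simpl; lia]. Qed.

Lemma bounded_thr ps i : i + length ps <= N -> bounded (Ext (thr_at ps i)).
Proof.
intros H. split; [constructor|]. cbn [form_size].
pose proof (thr_at_size H). lia.
Qed.

Lemma bounded_pd p ps i ps' i' :
  i + length ps <= N -> i' + length ps' <= N ->
  bounded (pd (Ext (thr_at ps i)) p (Ext (thr_at ps' i'))).
Proof.
intros H H'. split; [repeat constructor|]. cbn [form_size pd].
pose proof (thr_at_size H). pose proof (thr_at_size H'). lia.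
Qed.

Lemma thr_at_cons p ps i :
  thr_axioms (thr_at (p :: ps) i)
    (pd (Ext (thr_at ps i)) p (Ext (thr_at ps (S i)))).
Proof.
unfold thr_at.
replace (K - Z.of_nat (S i))%Z with (K - Z.of_nat i - 1)%Z by lia.
constructor.
Qed.

(** Every threshold variable has a defining axiom, and one unfolding is enough, so the cost does not
    grow with [ps]. *)
Lemma der_thr_refl H ps i :
  i + length ps <= N ->
  der thr_axioms bounded H 5 ([Ext (thr_at ps i)] ⊢ [Ext (thr_at ps i)]).
Proof.
intros Hi.
assert (HA : exists A, thr_axioms (thr_at ps i) A /\ bounded A).
{ destruct ps as [|p ps].
  - unfold thr_at. destruct (Z.eq_dec (K - Z.of_nat i) 0) as [->|Hne].
    + exists One. split; [constructor | split; [constructor | simpl; lia]].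
    + exists Zero.
      split; [constructor; exact Hne | split; [constructor | simpl; lia]].
  - eexists. split; [apply thr_at_cons|]. simpl in Hi.
    apply bounded_pd; lia. }
destruct HA as (A & HT & HA).
apply der_ext with (A := A); auto using bounded_thr.
Qed.

Lemma der_thr_congr H n p ps qs i :
  S i + length ps <= N -> length qs = length ps ->
  (forall j, j = i \/ j = S i ->
    der thr_axioms bounded H n ([Ext (thr_at ps j)] ⊢ [Ext (thr_at qs j)])) ->
  der thr_axioms bounded H (3 * n + 100)
    ([Ext (thr_at (p :: ps) i)] ⊢ [Ext (thr_at (p :: qs) i)]).
Proof.
intros Hi Hl HD.
eapply der_mono with (n := 2 * n + n + 100); [|lia].
eapply der_pd_congr; try apply thr_at_cons; auto using bounded_var;
  try (apply bounded_thr; simpl; lia); apply bounded_pd; lia.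
Qed.

Lemma der_thr_swap H p q ps i :
  i + length (p :: q :: ps) <= N ->
  der thr_axioms bounded H 1000
    ([Ext (thr_at (p :: q :: ps) i)] ⊢ [Ext (thr_at (q :: p :: ps) i)]).
Proof.
intros Hi. simpl in Hi.
eapply der_pd_swap; try apply thr_at_cons; auto.
- intros x Hx. simpl in Hx.
  repeat (destruct Hx as [<-|Hx];
    [first [apply bounded_var | apply bounded_thr; simpl; lia
           | apply bounded_pd; simpl; lia]|]).
  destruct Hx.
- intros x Hx. simpl in Hx.
  repeat (destruct Hx as [<-|Hx]; [apply der_thr_refl; lia|]).
  destruct Hx.
Qed.

Definition implications (ps qs : list var) (S : sequent thr) : Prop :=
  exists i, i + length ps <= N /\
    ([Ext (thr_at ps i)] ⊢ [Ext (thr_at qs i)]) = S.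

Lemma implications_extends_by H c ps qs :
  (forall i, i + length ps <= N ->
    der thr_axioms bounded H c ([Ext (thr_at ps i)] ⊢ [Ext (thr_at qs i)])) ->
  extends_by thr_axioms bounded (c * S N) H (implications ps qs).
Proof.
intros HD.
assert (Hf : forall i, i < S N - length ps -> der thr_axioms bounded H c
  ([Ext (thr_at ps i)] ⊢ [Ext (thr_at qs i)])) by (intros i Hi; apply HD; lia).
eapply extends_by_mono; [apply (der_family_extends_by bounded_positive Hf) | |].
- apply Nat.mul_le_mono_l; lia.
- intros S (i & Hi & <-). exists i; split; [lia | reflexivity].
Qed.

(** Listed implications cost no line, which keeps the factor 3 of the congruence from compounding
    along the induction. *)
Lemma der_implication (H : sequent thr -> Prop) ps qs i :
  (forall S, implications ps qs S -> H S) ->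
  length qs = length ps -> i + length ps <= N ->
  der thr_axioms bounded H 0 ([Ext (thr_at ps i)] ⊢ [Ext (thr_at qs i)]).
Proof.
intros HH Hl Hi. apply der_hyp.
- apply HH. exists i; auto.
- repeat split; simpl; try (constructor; auto; apply bounded_thr; lia).
  unfold width; lia.
Qed.

(** For each entry [x] passed, transpose [p] and [x] at the head, then apply the congruence under
    [x] to the family already listed. *)
Lemma move_extends_by p xs ys :
  extends_by thr_axioms bounded (2000 * S N * S (length xs)) (fun _ => False)
    (implications (p :: xs ++ ys) (xs ++ p :: ys)).
Proof.
induction xs as [|x xs IH].
- eapply extends_by_mono with (n := 5 * S N); [| cbn [length]; lia | intros S HS; exact HS].
  apply implications_extends_by. intros i Hi; apply der_thr_refl; exact Hi.
- eapply extends_by_mono; [eapply extends_by_trans; [exact IH|] | |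
    intros S HS; exact HS].
  (* 1000 lines for the transposition, 100 for the congruence from listed premises, 3 for the
     cut. *)
  + apply implications_extends_by with (c := 1103). simpl. intros i Hi.
    apply der_cut_single with (n1 := 1000) (n2 := 100)
      (B := Ext (thr_at (x :: p :: xs ++ ys) i)).
    * apply der_thr_swap; simpl; lia.
    * apply der_thr_congr with (n := 0); [simpl; lia | |].
      -- simpl; rewrite !length_app; simpl; lia.
      -- intros j Hj. apply der_implication; auto.
         ++ simpl; rewrite !length_app; simpl; lia.
         ++ simpl; lia.
  + cbn [length]. nia.
Qed.

Lemma permutation_extends_by ps qs :
  Permutation ps qs -> length ps <= N ->
  extends_by thr_axioms bounded (3000 * S N * S N * S (length ps))
    (fun _ => False) (implications ps qs).
Proof.
revert qs; induction ps as [|p ps IH]; intros qs HP HN.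
- apply Permutation_nil in HP; subst.
  eapply extends_by_mono with (n := 5 * S N);
    [| cbn [length]; nia | intros S HS; exact HS].
  apply implications_extends_by. intros i Hi; apply der_thr_refl; exact Hi.
- destruct (in_split p qs) as (q1 & q2 & ->).
  { apply (Permutation_in _ HP); left; reflexivity. }
  apply Permutation_cons_app_inv in HP. simpl in HN.
  pose proof (Permutation_length HP) as Hl. rewrite length_app in Hl.
  pose proof (extends_by_union (IH _ HP (Nat.lt_le_incl _ _ HN))
                (move_extends_by p q1 q2)) as HU.
  eapply extends_by_mono; [eapply extends_by_trans; [exact HU|] | |
    intros S HS; exact HS].
  + apply implications_extends_by with (c := 103). simpl. intros i Hi.
    apply der_cut_single with (n1 := 100) (n2 := 0)
      (B := Ext (thr_at (p :: q1 ++ q2) i)).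
    * apply der_thr_congr with (n := 0); [lia | rewrite length_app; lia |].
      intros j Hj. apply der_implication; auto;
        rewrite ?length_app; lia.
    * apply der_implication; auto; simpl;
        rewrite !length_app; simpl; lia.
  (* The move costs at most 2000 (N+1)^2 lines and the congruence family 103 (N+1), within the 3000
     (N+1)^2 allowed per entry. *)
  + cbn [length]. assert (length q1 <= N) by lia. nia.
Qed.

(** * From line counts to symbol counts *)

Lemma good_size S :
  good bounded S -> seq_size thr_size S <= 80 * (1 + N + numeral_size K).
Proof.
intros (HG & HD & Hw). unfold seq_size.
assert (HL : forall L, Forall bounded L ->
  list_sum (map (form_size thr_size) L)
    <= length L * (6 * (1 + N + numeral_size K))).
{ induction 1 as [|A L [_ HA] _ IH]; simpl in *; lia. }
(* At most 12 formulas of 6 units each, plus the sequent arrow, stay below 80 units. *)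
apply HL in HG; apply HL in HD. unfold width in Hw. nia.
Qed.

Lemma proof_size_good b :
  Forall (good bounded) b ->
  proof_size thr_size b <= length b * (80 * (1 + N + numeral_size K)).
Proof.
unfold proof_size. induction 1 as [|S b HS _ IH]; [simpl; lia|].
apply good_size in HS. cbn [map length list_sum fold_right] in *.
change (fold_right Init.Nat.add 0) with list_sum. lia.
Qed.

End Threshold.

Lemma permutation_proof ps qs k :
  Permutation ps qs ->
  let S := [Ext (Thr ps k)] ⊢ [Ext (Thr qs k)] in
  exists pf, proof_of thr_axioms pf S /\
    proof_size thr_size pf <= 3000 * 80 * seq_size thr_size S ^ 4.
Proof.
intros HP S.
assert (Hthr : forall l, Thr l k = thr_at k l 0).
{ intros l; unfold thr_at; f_equal; lia. }
(* Here [N] is [length ps]; the wanted sequent is the member [i = 0] of the family. *)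
destruct (permutation_extends_by k HP (le_n _) (d_nil thr_axioms))
  as (b & Lb & Fb & Db & Ib); [intros ? []|]. simpl in Db, Ib.
destruct (Ib S) as (S' & HS' & He).
{ exists 0. unfold S. rewrite !Hthr. split; [simpl; lia | reflexivity]. }
(* With one formula on each side, multiset equality is equality, so [S] itself is a line. *)
assert (S' = S) as ->.
{ destruct S' as [G D], He as [HG HD]; simpl in HG, HD.
  apply Permutation_length_1_inv in HG.
  apply Permutation_length_1_inv in HD. subst; reflexivity. }
apply in_split in HS'. destruct HS' as (b1 & b2 & ->).
exists (b1 ++ [S]). split.
- split; [| exists b1; reflexivity].
  apply derivation_prefix with (pf2 := b2). rewrite <- app_assoc. exact Db.
- replace (b1 ++ S :: b2) with ((b1 ++ [S]) ++ b2) in Fb, Lb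
    by (rewrite <- app_assoc; reflexivity).
  apply Forall_app in Fb. destruct Fb as [Fb _].
  rewrite length_app in Lb.
  apply proof_size_good in Fb.
  assert (Hs : 1 + length ps + numeral_size k <= seq_size thr_size S)
    by (unfold S, seq_size; simpl; lia).
  set (s := seq_size thr_size S) in *. clearbody s.
  (* Each of the three factors of the line count is [length ps + 1], hence at most [s]; the linear
     line size supplies the fourth power. *)
  assert (L : length (b1 ++ [S]) <= 3000 * (s * s * s)).
  { etransitivity; [eapply Nat.le_trans; [|exact Lb]; lia|].
    rewrite <- !Nat.mul_assoc. apply Nat.mul_le_mono_l.
    repeat apply Nat.mul_le_mono; lia. }
  etransitivity; [exact Fb|].
  etransitivity.
  { apply Nat.mul_le_mono; [exact L | apply Nat.mul_le_mono_l; exact Hs]. }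
  assert (Hring : forall a b x, a * (x * x * x) * (b * x) = a * b * x ^ 4)
    by (intros; simpl; ring).
  rewrite Hring. apply le_n.
Qed.

Theorem mainTheorem3 :
  exists c d : nat,
  forall (ps qs : list var) (k : Z), Permutation ps qs ->
    let S1 := [Ext (Thr ps k)] ⊢ [Ext (Thr qs k)] in
    let S2 := [Ext (Thr qs k)] ⊢ [Ext (Thr ps k)] in
    (exists pf, proof_of thr_axioms pf S1 /\
       proof_size thr_size pf <= c * seq_size thr_size S1 ^ d + c) /\
    (exists pf, proof_of thr_axioms pf S2 /\
       proof_size thr_size pf <= c * seq_size thr_size S2 ^ d + c).
Proof.
(* Making the constant a variable keeps its large unary value out of the arithmetic below. *)
assert (Hc : exists c, forall ps qs k, Permutation ps qs ->
  let S := [Ext (Thr ps k)] ⊢ [Ext (Thr qs k)] in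
  exists pf, proof_of thr_axioms pf S /\
    proof_size thr_size pf <= c * seq_size thr_size S ^ 4)
  by (eexists; apply permutation_proof).
destruct Hc as [c Hc]. exists c, 4. intros ps qs k HP S1 S2. split.
- destruct (Hc ps qs k HP) as (pf & Hpf & Hs).
  exists pf; split; [exact Hpf | unfold S1; lia].
- destruct (Hc qs ps k (Permutation_sym HP)) as (pf & Hpf & Hs).
  exists pf; split; [exact Hpf | unfold S2; lia].
Qed.
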